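(* Let $R$ be a ring, $n\ge 0$ an integer, $I$ an $(n-1)$-presented two-sided ideal of $R$, $M$ an $R/I$-module and $\mathscr{X}$ a class of submodules of $M$. Then $M$ is $n$-$\mathscr{X}$-coherent as an $R$-module if and only if $M$ is $n$-$\mathscr{X}$-coherent as an $R/I$-module.
   Context: Rings are associative with identity (not necessarily commutative); modules are unital left modules. For an integer $k\ge 0$, a module $M$ is $k$-presented if there is an exact sequence $F_k\to F_{k-1}\to\cdots\to F_0\to M\to 0$ with each $F_i$ a finitely generated free module (over the ring in question); every module is regarded as $(-1)$-presented. For a class $\mathscr{X}$ of modules, $\mathscr{X}_k$ denotes the class of $k$-presented modules in $\mathscr{X}$. If $\mathscr{X}$ is a class of submodules of a module $M$, then $M$ is $n$-$\mathscr{X}$-coherent if $\mathscr{X}_{n-1}$ is nonempty and every module in $\mathscr{X}_{n-1}$ is in $\mathscr{X}_n$. An $R/I$-module is viewed as an $R$-module via the canonical map $R\to R/I$ (the $R$-submodules and the $R/I$-submodules of $M$ coincide); the ideal $I$ is $(n-1)$-presented as an $R$-module. *)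

(* Defs.v *)
From HB Require Import structures.
From mathcomp Require Import all_boot all_order all_algebra.
From mathcomp Require Import all_classical.

Set Implicit Arguments.
Unset Strict Implicit.
Unset Printing Implicit Defensive.

Import GRing.Theory.
Local Open Scope ring_scope.
Local Open Scope classical_set_scope.

(* Rings are [pzRingType]: not necessarily commutative, possibly zero, so that
   R / I makes sense even for I = R.  Submodules and ideals are boolean
   predicates; under the classical axioms of [boolp] these are all subsets. *)

HB.mixin Record isTwoSidedIdeal (R : pzRingType) (I : R -> bool) := {
  ideal_mull : forall (a : R), {in I, forall x : R, a * x \in I};
  ideal_mulr : forall (a : R), {in I, forall x : R, x * a \in I}
}.

#[short(type="twoSidedIdeal")]
HB.structure Definition TwoSidedIdeal (R : pzRingType) :=
  {I of GRing.ZmodClosed R I & isTwoSidedIdeal R I}.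

Section LeftIdeal.
Variables (R : pzRingType) (I : twoSidedIdeal R).

Definition left_ideal_pred : {pred R^o} := (I : {pred R}).

Fact left_ideal_closed : submod_closed left_ideal_pred.
Proof.
split=> [|a x y xI yI]; first exact: (@rpred0 _ I).
by apply: (@rpredD _ I) => //; apply: ideal_mull.
Qed.

HB.instance Definition _ :=
  GRing.isSubmodClosed.Build R R^o left_ideal_pred left_ideal_closed.

Definition left_ideal : submodClosed R^o := left_ideal_pred.

End LeftIdeal.

(* [ring_quotient] only equips quotients of commutative nonzero rings by proper
   ideals with a ring structure; its additive quotient is reused here. *)
Section QuotientRing.
Local Open Scope quotient_scope.
Variables (R : pzRingType) (I : twoSidedIdeal R).

Definition ring_quot : Type := Quotient.quot I.

HB.instance Definition _ := GRing.Zmodule.on ring_quot.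

Definition ring_proj (x : R) : ring_quot := \pi_(Quotient.quot I) x.

Fact ring_proj_surj (y : ring_quot) : exists x, ring_proj x = y.
Proof. by exists (repr (y : Quotient.quot I)); rewrite /ring_proj reprK. Qed.

Fact ring_projE (x y : R) : (ring_proj x == ring_proj y) = (x - y \in I).
Proof. by rewrite Quotient.idealrBE. Qed.

Fact ring_proj_zmod : zmod_morphism ring_proj.
Proof. by move=> x y; rewrite /ring_proj !piE. Qed.

Definition ring_quot_one : ring_quot := ring_proj 1.

Definition ring_quot_mul (x y : ring_quot) : ring_quot :=
  ring_proj (repr (x : Quotient.quot I) * repr (y : Quotient.quot I)).

Fact ring_proj_mul x y :
  ring_proj (x * y) = ring_quot_mul (ring_proj x) (ring_proj y).
Proof.
have repr_proj z : z - repr (ring_proj z : Quotient.quot I) \in I.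
  by rewrite -ring_projE /ring_proj reprK.
apply/eqP; rewrite ring_projE.
set x' := repr _; set y' := repr _.
have -> : x * y - x' * y' = (x - x') * y + x' * (y - y').
  by rewrite mulrBl mulrBr addrA subrK.
by apply: rpredD; [apply: ideal_mulr | apply: ideal_mull].
Qed.

Fact ring_quot_mulA : associative ring_quot_mul.
Proof.
move=> x y z.
have [a <-] := ring_proj_surj x; have [b <-] := ring_proj_surj y.
by have [c <-] := ring_proj_surj z; rewrite -!ring_proj_mul mulrA.
Qed.

Fact ring_quot_1mul : left_id ring_quot_one ring_quot_mul.
Proof.
by move=> x; have [a <-] := ring_proj_surj x; rewrite -ring_proj_mul mul1r.
Qed.

Fact ring_quot_mul1 : right_id ring_quot_one ring_quot_mul.
Proof.
by move=> x; have [a <-] := ring_proj_surj x; rewrite -ring_proj_mul mulr1.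
Qed.

Fact ring_projD x y : ring_proj (x + y) = ring_proj x + ring_proj y.
Proof. by rewrite /ring_proj !piE. Qed.

Fact ring_quot_mulDl : left_distributive ring_quot_mul +%R.
Proof.
move=> x y z.
have [a <-] := ring_proj_surj x; have [b <-] := ring_proj_surj y.
have [c <-] := ring_proj_surj z.
by rewrite -(ring_projD a) -!ring_proj_mul -ring_projD mulrDl.
Qed.

Fact ring_quot_mulDr : right_distributive ring_quot_mul +%R.
Proof.
move=> x y z.
have [a <-] := ring_proj_surj x; have [b <-] := ring_proj_surj y.
have [c <-] := ring_proj_surj z.
by rewrite -(ring_projD b) -!ring_proj_mul -ring_projD mulrDr.
Qed.

HB.instance Definition _ := GRing.Zmodule_isPzRing.Build ring_quot
  ring_quot_mulA ring_quot_1mul ring_quot_mul1 ring_quot_mulDl ring_quot_mulDr.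

Fact ring_proj_monoid : monoid_morphism ring_proj.
Proof. by split=> [|x y]; [|exact: ring_proj_mul]. Qed.

HB.instance Definition _ :=
  GRing.isZmodMorphism.Build R ring_quot ring_proj ring_proj_zmod.
HB.instance Definition _ :=
  GRing.isMonoidMorphism.Build R ring_quot ring_proj ring_proj_monoid.

End QuotientRing.

(* The phantom argument f lets the scalar action be inferred from the type. *)
Definition restrict_scalars (R S : pzRingType) (f : {rmorphism R -> S})
    (M : lmodType S) : Type := M.

Section RestrictScalars.
Variables (R S : pzRingType) (f : {rmorphism R -> S}) (M : lmodType S).

HB.instance Definition _ := GRing.Zmodule.on (restrict_scalars f M).

Definition restrict_scale (a : R) (x : restrict_scalars f M) :
    restrict_scalars f M :=
  f a *: (x : M).

Fact restrict_scaleA a b x :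
  restrict_scale a (restrict_scale b x) = restrict_scale (a * b) x.
Proof. by rewrite /restrict_scale rmorphM scalerA. Qed.

Fact restrict_scale1 : left_id 1 restrict_scale.
Proof. by move=> x; rewrite /restrict_scale rmorph1 scale1r. Qed.

Fact restrict_scaleDr : right_distributive restrict_scale +%R.
Proof. by move=> a x y; rewrite /restrict_scale scalerDr. Qed.

Fact restrict_scaleDl x : {morph restrict_scale^~ x : a b / a + b}.
Proof. by move=> a b; rewrite /restrict_scale rmorphD scalerDl. Qed.

HB.instance Definition _ := GRing.Zmodule_isLmodule.Build
  R (restrict_scalars f M)
  restrict_scaleA restrict_scale1 restrict_scaleDr restrict_scaleDl.

Section Submodule.
Variable N : submodClosed M.

Definition restrict_pred : {pred restrict_scalars f M} := (N : {pred M}).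

Fact restrict_closed : submod_closed restrict_pred.
Proof.
split=> [|a x y xN yN]; first exact: (@rpred0 _ N).
by apply: (@rpredD _ N) => //; apply: (@rpredZ _ _ N).
Qed.

HB.instance Definition _ :=
  GRing.isSubmodClosed.Build R (restrict_scalars f M)
    restrict_pred restrict_closed.

Definition restrict_submod : submodClosed (restrict_scalars f M) :=
  restrict_pred.

End Submodule.
End RestrictScalars.

Arguments restrict_submod {R S} f {M} N.

Section SubmoduleType.
Variables (R : pzRingType) (M : lmodType R) (N : submodClosed M).

Definition submod_type : Type := {x : M | x \in N}.

HB.instance Definition _ := SubChoice.on submod_type.
HB.instance Definition _ := [SubChoice_isSubLmodule of submod_type by <:].

End SubmoduleType.

Definition fg_free (R : pzRingType) (F : lmodType R) : Prop :=
  exists (m : nat) (f : {linear 'rV[R]_m -> F}), bijective f.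

Definition exact_at (R : pzRingType) (A B C : lmodType R)
    (f : {linear A -> B}) (g : {linear B -> C}) : Prop :=
  range f = [set y | g y = 0].

(* The exact sequence F_k -> ... -> F_0 -> M -> 0 is given by d and eps; the
   modules F_i with i > k and the maps d_i with i >= k are unconstrained. *)
Definition nat_presented (R : pzRingType) (k : nat) (M : lmodType R) : Prop :=
  exists (F : nat -> lmodType R) (d : forall i, {linear F i.+1 -> F i})
         (eps : {linear F 0%N -> M}),
  [/\ forall i, (i <= k)%N -> fg_free (F i),
      range eps = setT,
      (0 < k)%N -> exact_at (d 0%N) eps
    & forall i, (i.+1 < k)%N -> exact_at (d i.+1) (d i)].

(* Only the degrees k >= -1 are meaningful. *)
Definition presented (R : pzRingType) (k : int) (M : lmodType R) : Prop :=
  match k with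
  | Posz k => nat_presented k M
  | Negz _ => True
  end.

Definition presented_in (R : pzRingType) (M : lmodType R)
    (X : set (submodClosed M)) (k : int) : set (submodClosed M) :=
  [set N | X N /\ presented k (submod_type N)].

Definition coherent (R : pzRingType) (n : nat) (M : lmodType R)
    (X : set (submodClosed M)) : Prop :=
  presented_in X (n%:Z - 1) !=set0 /\
  presented_in X (n%:Z - 1) `<=` presented_in X n%:Z.

(* Main.v *)
Require Import Defs.
From HB Require Import structures.
From mathcomp Require Import all_boot all_order all_algebra.
From mathcomp Require Import all_classical.

Local Open Scope ring_scope.
Local Open Scope classical_set_scope.

(** By dimension shifting, [k]-presentedness is governed by short exact
    sequences [0 -> A -> B -> C -> 0]: if [A] and [C] are [k]-presented, so is
    [B]; if [A] is [(k-1)]-presented and [B] is [k]-presented, so is [C]; if [B]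
    is [(k-1)]-presented and [C] is [k]-presented, so is [A].  Since [I] is
    [(n-1)]-presented, [R / I] is [n]-presented over [R], and then so is every
    finitely generated free [R / I]-module.  Covering an [R / I]-module by a
    free one and passing to the kernel, an induction on [k <= n] shows that
    being [k]-presented means the same over [R] and over [R / I]. *)

Import GRing.Theory.

Set Implicit Arguments.
Unset Strict Implicit.

(** * Short exact sequences, kernels and lifting *)

Section ShortExactSequences.
Variable R : pzRingType.
Implicit Types A B C D F K : lmodType R.

Definition short_exact A B C (f : A -> B) (g : B -> C) : Prop :=
  [/\ injective f, forall c, exists b, g b = c
    & forall b, g b = 0 <-> exists a, f a = b].

Lemma linear_bundle A B (f : A -> B) :
  linear f -> exists g : {linear A -> B}, g =1 f.
Proof.
move=> lf; pose g : {linear A -> B} :=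
  HB.pack f (GRing.isLinear.Build R A B _ f lf).
by exists g.
Qed.

Section Kernel.
Variables (B C : lmodType R) (g : {linear B -> C}).

Definition ker_pred : {pred B} := fun x => g x == 0.

Fact ker_pred_closed : submod_closed ker_pred.
Proof.
split=> [|a x y]; first by rewrite unfold_in linear0.
by rewrite !unfold_in linearP => /eqP-> /eqP->; rewrite scaler0 addr0.
Qed.

HB.instance Definition _ :=
  GRing.isSubmodClosed.Build R B ker_pred ker_pred_closed.

Lemma short_exact_ker : (forall c, exists b, g b = c) ->
  exists (K : lmodType R) (f : {linear K -> B}), short_exact f g.
Proof.
move=> gS; exists (submod_type ker_pred), \val.
split=> [||b]; [exact: val_inj | exact: gS |].
split=> [gb|[a <-]]; last by apply/eqP; exact: (valP a).
have kb : b \in ker_pred by rewrite unfold_in gb.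
by exists (exist _ b kb).
Qed.

End Kernel.

(** Injectivity of [f] makes preimages unique, so the preimages picked by choice automatically form
    a linear map. *)
Lemma short_exact_lift A B C D (f : {linear A -> B}) (g : {linear B -> C})
    (h : {linear D -> B}) :
  short_exact f g -> (forall d, g (h d) = 0) ->
  exists h' : {linear D -> A}, forall d, f (h' d) = h d.
Proof.
move=> [fI _ fg] gh.
have /choice[h0 fh0] : forall d, exists a, f a = h d by move=> d; apply/fg.
have lh0 : linear h0 by move=> a x y; apply: fI; rewrite linearP !fh0 linearP.
by have [h' h'E] := linear_bundle lh0; exists h' => d; rewrite h'E.
Qed.

(** Projectivity: preimages are chosen for the standard basis only, then extended linearly along the
    coordinates [f']. *)
Lemma fg_free_lift F B C (g : {linear B -> C}) (h : {linear F -> C}) :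
  fg_free F -> (forall c, exists b, g b = c) ->
  exists h' : {linear F -> B}, forall x, g (h' x) = h x.
Proof.
move=> [m [f [f' fK f'K]]] gS.
have /choice[e eE] : forall i : 'I_m, exists b, g b = h (f (delta_mx 0 i)).
  by move=> i; apply: gS.
have lf' : linear f'.
  by move=> a x y; apply: (can_inj fK); rewrite linearP !f'K.
pose h0 x : B := \sum_i f' x 0 i *: e i.
have lh0 : linear h0.
  move=> a x y; rewrite /h0 lf' scaler_sumr -big_split; apply: eq_bigr => i _.
  by rewrite !mxE scalerDl scalerA.
have [h' h'E] := linear_bundle lh0; exists h' => x; rewrite h'E.
rewrite -[in RHS](f'K x) [in RHS](row_sum_delta (f' x)) !linear_sum.
by apply: eq_bigr => i _; rewrite !linearZ eE.
Qed.

Lemma fg_free_rV m : fg_free 'rV[R]_m.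
Proof. by exists m, idfun; exists id. Qed.

Lemma fg_free_regular : fg_free R^o.
Proof.
have lf : linear (fun v : 'rV[R]_1 => v 0 0 : R^o).
  by move=> a x y; rewrite !mxE.
have [f fE] := linear_bundle lf.
exists 1%N, f; exists (fun x => \row__ x) => x; last by rewrite fE mxE.
by apply/rowP => i; rewrite mxE fE ord1.
Qed.

Lemma fg_free_prod F F' : fg_free F -> fg_free F' -> fg_free (F * F')%type.
Proof.
move=> [m [f [f1 fK f1K]]] [p [f' [f1' fK' f1K']]].
have lf : linear (fun v : 'rV[R]_(m + p) => (f (lsubmx v), f' (rsubmx v))).
  by move=> a x y; rewrite !linearP.
have [h hE] := linear_bundle lf.
exists (m + p)%N, h; exists (fun x => row_mx (f1 x.1) (f1' x.2)) => x.
  by rewrite hE /= fK fK' hsubmxK.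
by rewrite hE row_mxKl row_mxKr f1K f1K'; case: x.
Qed.

(** * Finite free resolutions as iterated short exact sequences *)

(* The index is shifted: [resolved k] stands for being [(k-1)]-presented. *)
Fixpoint resolved (k : nat) (M : lmodType R) : Prop :=
  if k is k'.+1 then
    exists (K F : lmodType R) (f : {linear K -> F}) (g : {linear F -> M}),
    [/\ fg_free F, short_exact f g & resolved k' K]
  else True.

Lemma resolved_iso k A B (f : {linear A -> B}) :
  bijective f -> resolved k A -> resolved k B.
Proof.
case: k => // k [f' fK f'K] [K [F [i [p [Ff [iI pS ip] rK]]]]].
exists K, F, i, (f \o p); split=> //; split=> // [b|x] /=.
  by have [x px] := pS (f' b); exists x; rewrite /= px f'K.
rewrite -ip; split=> [fpx|->]; last by rewrite linear0.
by apply: (can_inj fK); rewrite fpx linear0.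
Qed.

Lemma fg_free_resolved k F : fg_free F -> resolved k F.
Proof.
elim: k F => // k IH F Ff.
(* The identity cover has zero kernel, encoded as ['rV[R]_0] so that it is again free and the
   induction continues. *)
exists 'rV[R]_0, F, \0, idfun; split=> //; last exact/IH/fg_free_rV.
split=> [x y _|c|b]; first by rewrite [x]thinmx0 [y]thinmx0.
  by exists c.
by split=> [/= ->|[a <-]] //; exists 0.
Qed.

Lemma resolvedS k M : resolved k.+1 M -> resolved k M.
Proof.
elim: k M => // k IH M [K [F [i [p [Ff ip rK]]]]].
by exists K, F, i, p; split=> //; apply: IH.
Qed.

(** Horseshoe lemma: lifting the cover of [C] to [B] yields a cover of [B] by [FA * FC], whose
    kernel is an extension of [KC] by [KA]; the induction applies to these kernels. *)
Lemma resolved_mid k A B C (f : {linear A -> B}) (g : {linear B -> C}) :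
  short_exact f g -> resolved k A -> resolved k C -> resolved k B.
Proof.
elim: k A B C f g => // k IH A B C f g [fI gS fg].
move=> [KA [FA [iA [pA [FfA [iAI pAS ipA] rKA]]]]].
move=> [KC [FC [iC [pC [FfC eC rKC]]]]]; have [iCI pCS ipC] := eC.
have gf a : g (f a) = 0 by apply/fg; exists a.
have [h gh] := fg_free_lift pC FfC gS.
have lp : linear (fun x : FA * FC => f (pA x.1) + h x.2).
  by move=> a x y /=; rewrite !linearP scalerDr addrACA.
have [p pE] := linear_bundle lp.
have pS b : exists x, p x = b.
  have [y gy] := pCS (g b).
  have /fg[a fa] : g (b - h y) = 0 by rewrite linearB gh gy subrr.
  have [x pAx] := pAS a.
  by exists (x, y); rewrite pE /= pAx fa subrK.
have [K [i eK]] := short_exact_ker pS; have [iI _ ip] := eK.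
have pi x : p (i x) = 0 by apply/ip; exists x.
(* [u] and [v] are the maps on kernels induced by the inclusion of [FA] and the projection onto
   [FC]. *)
have lu : linear (fun x : KA => (iA x, 0 : FC)).
  by move=> a x y; rewrite linearP; congr pair; rewrite /= scaler0 addr0.
have [u0 u0E] := linear_bundle lu.
have [u uE] : exists u : {linear KA -> K}, forall x, i (u x) = u0 x.
  apply: short_exact_lift eK _ => x; rewrite pE u0E /=.
  by have /ipA-> : exists a, iA a = iA x; [exists x|rewrite !linear0 addr0].
have ls : linear (fun x : K => (i x).2) by move=> a x y; rewrite linearP.
have [v0 v0E] := linear_bundle ls.
have [v vE] : exists v : {linear K -> KC}, forall x, iC (v x) = v0 x.
  apply: short_exact_lift eC _ => x; rewrite v0E -gh.
  by have := congr1 g (pi x); rewrite pE linearD gf add0r linear0.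
exists K, (FA * FC)%type, i, p; split=> //; first exact: fg_free_prod.
apply: (IH _ _ _ u v) => //; split=> [x y uxy|c|b].
- by apply: iAI; have := congr1 i uxy; rewrite !uE !u0E => -[].
(* Surjectivity of [v]: [h (iC c)] comes from [A], and correcting by a lift to [FA] lands in the
   kernel of [p]. *)
- have /fg[a fa] : g (h (iC c)) = 0 by rewrite gh; apply/ipC; exists c.
  have [x pAx] := pAS a.
  have /ip[b ib] : p (- x, iC c) = 0 by rewrite pE /= !linearN pAx fa addNr.
  by exists b; apply: iCI; rewrite vE v0E ib.
split=> [vb|[a <-]]; last first.
  by apply: iCI; rewrite vE v0E uE u0E linear0.
have ib2 : (i b).2 = 0 by rewrite -v0E -vE vb linear0.
have /ipA[a ia] : pA (i b).1 = 0.
  by apply: fI; have := pi b; rewrite pE ib2 !linear0 addr0.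
by exists a; apply: iI; rewrite uE u0E ia -ib2; case: (i b).
Qed.

(** A free cover of [B] composed with [g] covers [C]; the kernel of the composite is an extension of
    [A] by [KB], to which [resolved_mid] applies. *)
Lemma resolved_coker k A B C (f : {linear A -> B}) (g : {linear B -> C}) :
  short_exact f g -> resolved k A -> resolved k.+1 B -> resolved k.+1 C.
Proof.
move=> efg rA [KB [F [i [p [Ff [iI pS ip] rKB]]]]]; have [fI gS fg] := efg.
have gpS c : exists x, (g \o p) x = c.
  by have [b <-] := gS c; have [x <-] := pS b; exists x.
have [K [j eK]] := short_exact_ker gpS; have [jI _ jgp] := eK.
have pi x : p (i x) = 0 by apply/ip; exists x.
have [u uE] : exists u : {linear KB -> K}, forall x, j (u x) = i x.
  by apply: short_exact_lift eK _ => x /=; rewrite pi linear0.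
have [v vE] : exists v : {linear K -> A}, forall x, f (v x) = (p \o j) x.
  by apply: short_exact_lift efg _ => x /=; apply/jgp; exists x.
exists K, F, j, (g \o p); split=> //.
apply: (resolved_mid (f := u) (g := v)) => //; split=> [x y uxy|a|x].
- by apply: iI; rewrite -!uE uxy.
- have [x px] := pS (f a).
  have /jgp[y jy] : (g \o p) x = 0 by rewrite /= px; apply/fg; exists a.
  by exists y; apply: fI; rewrite vE /= jy px.
split=> [vx|[a <-]]; last by apply: fI; rewrite vE /= uE pi linear0.
have /ip[a ia] : p (j x) = 0 by have := vE x; rewrite vx linear0.
by exists a; apply: jI; rewrite uE.
Qed.

(* A lift [F -> B] of a free cover [F -> C] gives a short exact sequence
   [0 -> K -> A (+) F -> B -> 0] with [K] the kernel of the cover; then [A] is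
   the cokernel of [F -> A (+) F]. *)
Lemma resolved_ker k A B C (f : {linear A -> B}) (g : {linear B -> C}) :
  short_exact f g -> resolved k B -> resolved k.+1 C -> resolved k A.
Proof.
move=> efg rB [K [F [i [p [Ff [iI pS ip] rK]]]]]; have [fI gS fg] := efg.
have pi x : p (i x) = 0 by apply/ip; exists x.
have gf a : g (f a) = 0 by apply/fg; exists a.
have [h gh] := fg_free_lift p Ff gS.
have ls : linear (fun x : A * F => f x.1 + h x.2).
  by move=> a x y /=; rewrite !linearP scalerDr addrACA.
have [s sE] := linear_bundle ls.
have [w wE] : exists w : {linear K -> A}, forall x, f (w x) = (h \o i) x.
  by apply: short_exact_lift efg _ => x /=; rewrite gh pi.
have lu : linear (fun x : K => (- w x, i x)).
  by move=> a x y; rewrite !linearP; congr pair; rewrite /= opprD scalerN.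
have [u uE] := linear_bundle lu.
have rAF : resolved k (A * F)%type.
  apply: (resolved_mid (f := u) (g := s)) => //; split=> [x y uxy|b|[a x]].
  - by apply: iI; move: uxy; rewrite !uE => -[].
  - have [x px] := pS (g b).
    have /fg[a fa] : g (b - h x) = 0 by rewrite linearB gh px subrr.
    by exists (a, x); rewrite sE /= fa subrK.
  split=> [|[y]]; last first.
    by rewrite uE sE => -[<- <-] /=; rewrite linearN wE addNr.
  rewrite sE /= => fah.
  have /ip[y iy] : p x = 0.
    by have := congr1 g fah; rewrite linearD gf add0r gh linear0.
  exists y; rewrite uE iy; congr pair; apply: fI.
  by rewrite linearN wE /= iy; apply/eqP; rewrite eq_sym -addr_eq0 fah.
(* [resolved_coker] concludes only at a successor index; index 0 is trivial. *)
case: k {rB rK} rAF => // k rAF.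
have lj : linear (fun x : F => (0 : A, x)).
  by move=> a x y; congr pair; rewrite /= scaler0 addr0.
have [j jE] := linear_bundle lj.
have lq : linear (fun x : A * F => x.1) by [].
have [q qE] := linear_bundle lq.
apply: (resolved_coker (f := j) (g := q)) rAF; last exact: fg_free_resolved.
split=> [x y|a|[a x]]; first by rewrite !jE => -[].
  by exists (a, 0); rewrite qE.
rewrite qE /=; split=> [->|[y]]; first by exists x; rewrite jE.
by rewrite jE => -[].
Qed.

(** A long resolution is cut at the kernel of its augmentation; conversely, a resolution of the
    kernel [K] is spliced onto [F0]. *)
Lemma nat_presentedP k M : nat_presented k M <-> resolved k.+1 M.
Proof.
split.
  elim: k M => [|k IH] M [F [d [eps [Ff epsS d0 dS]]]].
    have eS c : exists b, eps b = c.
      by have : setT c by []; rewrite -epsS => -[b _ <-]; exists b.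
    have [K [i ei]] := short_exact_ker eS.
    by exists K, (F 0), i, eps; split=> //; apply: Ff.
  have eS c : exists b, eps b = c.
    by have : setT c by []; rewrite -epsS => -[b _ <-]; exists b.
  have [K [i ei]] := short_exact_ker eS; have [iI _ ie] := ei.
  exists K, (F 0), i, eps; split=> //; first exact: Ff.
  have {}d0 := d0 isT.
  have ed x : eps (d 0 x) = 0.
    by have : range (d 0) (d 0 x) by [exists x]; rewrite d0.
  (* [d 0] factors through the kernel [K] of [eps]; the factor [e] is the augmentation of the
     shifted resolution. *)
  have [e eE] := short_exact_lift ei ed.
  apply: IH; exists (fun j => F j.+1), (fun j => d j.+1), e.
  split=> [j jk||k0|j jk]; first exact: Ff.
  - apply/seteqP; split=> // c _.
    have : [set y | eps y = 0] (i c) by apply/ie; exists c.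
    by rewrite -d0 => -[x _ dx]; exists x => //; apply: iI; rewrite eE.
  - rewrite /exact_at dS //; apply/seteqP; split=> x /= dx.
      by apply: iI; rewrite eE dx linear0.
    by rewrite -eE dx linear0.
  exact: dS.
elim: k M => [|k IH] M [K [F0 [i [p [Ff [iI pS ip] rK]]]]].
  (* For [k = 0] only degree 0 is constrained; all other modules and maps are fillers. *)
  exists (fun=> F0), (fun=> \0), p; split=> //.
  by apply/seteqP; split=> // c _; have [x <-] := pS c; exists x.
have [F [d [eps [FF epsS d0 dS]]]] := IH _ rK.
(* Splicing: the resolution of [K] moves up one degree and [i \o eps] is the connecting map. *)
pose F' j := if j is j'.+1 then F j' else F0.
pose d' j : {linear F' j.+1 -> F' j} :=
  match j with 0 => i \o eps | j'.+1 => d j' end.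
exists F', d', p; split=> [[|j] jk||_|[|j] jk] //.
- exact: FF.
- by apply/seteqP; split=> // c _; have [x <-] := pS c; exists x.
- apply/seteqP; split=> x /= => [[y _ <-]|/ip[y <-]].
    by apply/ip; exists (eps y).
  by have : setT y by []; rewrite -epsS => -[z _ <-]; exists z.
- rewrite /exact_at /= (d0 jk); apply/seteqP; split=> x /= ex.
    by rewrite ex linear0.
  by apply: iI; rewrite ex linear0.
- exact: dS.
Qed.

(** This form includes degree -1: at [n = 0] both sides are [True]. *)
Lemma presented_predP n M : presented (n%:Z - 1) M <-> resolved n M.
Proof.
case: n => [|n]; first by [].
have -> : n.+1%:Z - 1 = n%:Z by rewrite -addn1 PoszD addrK.
exact: nat_presentedP.
Qed.

End ShortExactSequences.

(** * Restriction of scalars along a ring morphism *)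

Section ChangeOfRings.
Variables (R S : pzRingType) (f : {rmorphism R -> S}).

Lemma restrict_linear (A B : lmodType S) (h : {linear A -> B}) :
  exists h' : {linear restrict_scalars f A -> restrict_scalars f B},
    forall x, h' x = h x.
Proof.
have lh : linear (h : restrict_scalars f A -> restrict_scalars f B).
  by move=> a x y; apply: (linearP h).
by have [h' h'E] := linear_bundle lh; exists h'.
Qed.

Lemma restrict_short_exact (A B C : lmodType S)
    (g : {linear A -> B}) (h : {linear B -> C}) :
  short_exact g h ->
  exists (g' : {linear restrict_scalars f A -> restrict_scalars f B})
         (h' : {linear restrict_scalars f B -> restrict_scalars f C}),
    short_exact g' h'.
Proof.
move=> [gI hS gh].
have [g' g'E] := restrict_linear g; have [h' h'E] := restrict_linear h.
exists g', h'; split=> [x y|c|b]; first by rewrite !g'E; apply: gI.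
  by have [b <-] := hS c; exists b.
rewrite h'E; split=> [/gh[a <-]|[a ga]]; first by exists a.
by apply/gh; exists a; rewrite -g'E.
Qed.

(** Splitting off one coordinate gives 0 -> S -> S^(m+1) -> S^m -> 0, so [resolved_mid] carries an
    induction on [m]. *)
Lemma restrict_rV_resolved k m :
  resolved k (restrict_scalars f S^o) ->
  resolved k (restrict_scalars f 'rV[S]_m).
Proof.
move=> rS; elim: m => [|m IH].
  apply: fg_free_resolved; exists 0, \0; exists (fun=> 0) => x.
    by rewrite [RHS]thinmx0.
  by rewrite [RHS](thinmx0 x).
have li : linear (fun x : S^o => row_mx (\row_(_ < 1) x) 0 : 'rV[S]_(1 + m)).
  move=> a x y; rewrite scale_row_mx add_row_mx scaler0 addr0; congr row_mx.
  by apply/rowP => j; rewrite !mxE.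
have [i iE] := linear_bundle li.
have lq : linear (fun x : 'rV[S]_(1 + m) => rsubmx x).
  by move=> a x y; rewrite linearP.
have [q qE] := linear_bundle lq.
have e : short_exact i q.
  split=> [x y|c|b].
  - by rewrite !iE => /eq_row_mx[/rowP/(_ 0)]; rewrite !mxE.
  - by exists (row_mx 0 c); rewrite qE row_mxKr.
  rewrite qE; split=> [b0|[x <-]]; last by rewrite iE row_mxKr.
  exists (lsubmx b 0 0); rewrite iE -[RHS](@hsubmxK _ _ 1) b0; congr row_mx.
  by apply/rowP => j; rewrite ord1 !mxE.
have [i' [q' e']] := restrict_short_exact e.
exact: resolved_mid e' rS IH.
Qed.

Lemma restrict_fg_free_resolved k (F : lmodType S) :
  resolved k (restrict_scalars f S^o) -> fg_free F ->
  resolved k (restrict_scalars f F).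
Proof.
move=> rS [m [h [h1 hK h1K]]]; have [h' h'E] := restrict_linear h.
apply: (resolved_iso (f := h')); last exact: restrict_rV_resolved.
by exists h1 => x; rewrite h'E; [apply: hK | apply: h1K].
Qed.

(** Generators over [R] also generate over [S]: since [R] acts through [f], applying [f] to the
    coefficients turns an [R]-combination into an [S]-combination. *)
Lemma restrict_fg_cover (N : lmodType S) :
  resolved 1 (restrict_scalars f N) ->
  exists (m : nat) (g : {linear 'rV[S]_m -> N}), forall y, exists x, g x = y.
Proof.
move=> [K [F [i [p [[m [h [h1 hK h1K]]] [_ pS _] _]]]]].
pose e j : N := p (h (delta_mx 0 j)).
have lg : linear (fun v : 'rV[S]_m => \sum_j v 0 j *: e j).
  move=> a x y; rewrite scaler_sumr -big_split; apply: eq_bigr => j _.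
  by rewrite !mxE scalerDl scalerA.
have [g gE] := linear_bundle lg.
exists m, g => y; have [x <-] := pS y.
exists (map_mx f (h1 x)); rewrite gE -[in RHS](h1K x).
rewrite [in RHS](row_sum_delta (h1 x)) !linear_sum.
by apply: eq_bigr => j _; rewrite mxE !linearZ.
Qed.

Lemma restrict_resolved n k (N : lmodType S) :
  resolved n (restrict_scalars f S^o) -> (k <= n)%N ->
  resolved k (restrict_scalars f N) <-> resolved k N.
Proof.
move=> rSn; have rS j : (j <= n)%N -> resolved j (restrict_scalars f S^o).
  move/subnK => nE; move: rSn; rewrite -nE.
  by elim: (n - j)%N => // l IH /resolvedS.
elim: k N => // k IH N kn; split.
  move=> rN.
  (* Only finite generation over [R] is used here, to obtain a cover that is free over [S]; its
     kernel then sits one index lower. *)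
  have [m [g gS]] : exists m (g : {linear 'rV[S]_m -> N}),
      forall y, exists x, g x = y.
    apply: restrict_fg_cover; elim: k {IH kn} rN => // k IH' /resolvedS.
    exact: IH'.
  have [K [i e]] := short_exact_ker gS.
  have [i' [g' e']] := restrict_short_exact e.
  exists K, 'rV[S]_m, i, g; split=> //; first exact: fg_free_rV.
  apply/IH; first exact: ltnW.
  by apply: resolved_ker e' _ rN; apply/restrict_rV_resolved/rS/ltnW.
move=> [K [F [i [p [Ff e rK]]]]]; have [i' [p' e']] := restrict_short_exact e.
apply: resolved_coker e' _ _; first by apply/IH => //; exact: ltnW.
by apply: restrict_fg_free_resolved Ff; apply: rS.
Qed.

(** Restricting scalars before or after passing to the submodule gives distinct types with the same
    elements; the identity is linear both ways. *)
Lemma restrict_submod_resolved k (M : lmodType S) (N : submodClosed M) :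
  resolved k (submod_type (restrict_submod f N)) <->
  resolved k (restrict_scalars f (submod_type N)).
Proof.
pose u (x : submod_type (restrict_submod f N)) :
  restrict_scalars f (submod_type N) := Sub (val x) (valP x).
pose v (x : restrict_scalars f (submod_type N)) :
  submod_type (restrict_submod f N) :=
  Sub (val (x : submod_type N)) (valP (x : submod_type N)).
have uK : cancel u v by move=> x; apply: val_inj.
have vK : cancel v u by move=> x; apply: (@val_inj _ _ (submod_type N)).
have lu : linear u.
  by move=> a x y; apply: (@val_inj _ _ (submod_type N)).
have lv : linear v by move=> a x y; apply: (can_inj uK); rewrite lu !vK.
have [u' u'E] := linear_bundle lu; have [v' v'E] := linear_bundle lv.
by split; [apply: (resolved_iso (f := u')) | apply: (resolved_iso (f := v'))];
  [exists v => x; rewrite u'E | exists u => x; rewrite v'E].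
Qed.

End ChangeOfRings.

(** * The quotient ring as a module over [R], and coherence *)

(** In 0 -> I -> R -> R/I -> 0 the middle term is free, so the cokernel gains one index over [I]. *)
Lemma ring_quot_resolved (R : pzRingType) (I : twoSidedIdeal R) n :
  resolved n (submod_type (left_ideal I)) ->
  resolved n.+1 (restrict_scalars (ring_proj I) (ring_quot I)^o).
Proof.
move=> rI.
pose i : {linear submod_type (left_ideal I) -> R^o} := \val.
have lq : linear
    (ring_proj I : R^o -> restrict_scalars (ring_proj I) (ring_quot I)^o).
  by move=> a x y; rewrite rmorphD rmorphM.
have [q qE] := linear_bundle lq.
apply: (resolved_coker (f := i) (g := q)) => //; last first.
  exact/fg_free_resolved/fg_free_regular.
split=> [|c|b]; first exact: val_inj.
  by have [x <-] := ring_proj_surj c; exists x.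
have qb : q b = 0 <-> b \in left_ideal I.
  (* Membership of [b] is read as membership of [b - 0], which [ring_projE] turns into an equality
     of classes. *)
  rewrite qE -[b in b \in _]subr0 -[_ \in _]ring_projE rmorph0.
  by split=> [->|/eqP].
split=> [qb0|[x xb]]; last by apply: qb.2; rewrite -xb; exact: (valP x).
have bI := qb.1 qb0.
by exists (exist _ b bI).
Qed.

Theorem theorem2p9 (R : pzRingType) (n : nat) (I : twoSidedIdeal R)
    (hI : presented (n%:Z - 1) (submod_type (left_ideal I)))
    (M : lmodType (ring_quot I)) (X : set (submodClosed M)) :
  coherent (M := restrict_scalars (ring_proj I) M) n
    (restrict_submod (ring_proj I) @` X)
  <-> coherent (M := M) n X.
Proof.
have /presented_predP/ring_quot_resolved rQ := hI.
(* With the shifted index, the bound [n.+1] reaches both degrees in coherence: [n - 1] is index [n]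
   and [n] is index [n.+1]. *)
have resE k (N : submodClosed M) : (k <= n.+1)%N ->
    resolved k (submod_type (restrict_submod (ring_proj I) N)) <->
    resolved k (submod_type N).
  move=> kn; apply: (iff_trans (restrict_submod_resolved _ _ _)).
  exact: restrict_resolved rQ kn.
have predE (N : submodClosed M) :
    presented (n%:Z - 1) (submod_type (restrict_submod (ring_proj I) N)) <->
    presented (n%:Z - 1) (submod_type N).
  apply: (iff_trans (presented_predP _ _)).
  apply: (iff_trans _ (iff_sym (presented_predP _ _))).
  exact: resE (leqnSn n).
have natE (N : submodClosed M) :
    presented n%:Z (submod_type (restrict_submod (ring_proj I) N)) <->
    presented n%:Z (submod_type N).
  apply: (iff_trans (nat_presentedP _ _)).
  apply: (iff_trans _ (iff_sym (nat_presentedP _ _))).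
  exact: resE (leqnn _).
split=> -[[N [XN pN]] sub]; split.
- by case: XN pN => N' XN' <- /predE pN'; exists N'.
- move=> N' [XN' pN']; split=> //; apply/natE.
  (* [X N'] is already at hand, so only the presentation is extracted from membership over [R]. *)
  suff [] : presented_in (restrict_submod (ring_proj I) @` X) n%:Z
      (restrict_submod (ring_proj I) N') by [].
  by apply: sub; split; [exists N'|apply/predE].
- by exists (restrict_submod (ring_proj I) N); split; [exists N|apply/predE].
move=> _ [[N' XN' <-] /predE pN']; split; first by exists N'.
by apply/natE; have [] : presented_in X n%:Z N' by apply: sub.
Qed.
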